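(* Let $P=\{x\in\mathbb{R}^n : H^Tx\le \mathbb{1}\}$ be a full-dimensional polytope with the origin in its interior, with $f$ facets and $v$ vertices, and let $K\subset\mathbb{R}^m$ be a closed convex cone. Let $A$ be a nonnegative $K^*$-map from $\mathbb{R}^f$ to $\mathbb{R}^m$ and $B$ a nonnegative $K$-map from $\mathbb{R}^v$ to $\mathbb{R}^m$, and assume that $\mathrm{Inn}_P(A)$ and $\mathrm{Inn}_{P^\circ}(B)$ are closed. Then $$\mathrm{Out}_{P^\circ}(A)=(\mathrm{Inn}_P(A))^\circ,\qquad \mathrm{Inn}_{P^\circ}(B)=(\mathrm{Out}_P(B))^\circ .$$
   Context: Dual spaces are identified with the spaces themselves via the standard inner product; $\|\cdot\|$ is the Euclidean norm and $\mathbb{1}$ is the all-ones vector. $H=[h_1\ \cdots\ h_f]$ is an $n\times f$ matrix such that each inequality $\langle h_i,x\rangle\le 1$ defines a facet of $P$ (one for each facet); $p_1,\dots,p_v$ are the vertices of $P$ and $V=[p_1\ \cdots\ p_v]$ is $n\times v$. $K^*=\{y : \langle y,x\rangle\ge 0\ \forall x\in K\}$ is the dual cone. A nonnegative $K$-map $B:\mathbb{R}^v\to\mathbb{R}^m$ is a linear map with $B(\mathbb{R}^v_+)\subseteq K$; a nonnegative $K^*$-map $A:\mathbb{R}^f\to\mathbb{R}^m$ satisfies $A(\mathbb{R}^f_+)\subseteq K^*$. Superscript $*$ on a linear map denotes the adjoint (transpose). The polar of a set $C\subseteq\mathbb{R}^n$ is $C^\circ=\{y : \langle y,x\rangle\le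 1\ \forall x\in C\}$. The polar polytope $P^\circ$ has facet inequalities $\langle y,p_j\rangle\le 1$ ($j=1,\dots,v$) and vertices $h_1,\dots,h_f$. Cones: $\mathcal{O}_{in}^k=\{x\in\mathbb{R}^k : \sqrt{k-1}\,\|x\|\le \mathbb{1}^Tx\}$ and $\mathcal{O}_{out}^k=\{x\in\mathbb{R}^k : \|x\|\le \mathbb{1}^Tx\}$. Definitions: $\mathrm{Inn}_P(A)=\{x\in\mathbb{R}^n : \exists y\in K,\ \mathbb{1}-H^*(x)-A^*(y)\in\mathcal{O}_{in}^f\}$, $\mathrm{Out}_P(B)=\{V(z) : z\in\mathcal{O}_{out}^v,\ \mathbb{1}^Tz\le 1,\ B(z)\in K\}$. For $P^\circ$, the roles of facets and vertices (and of $K$ and $K^*$) are exchanged: $\mathrm{Inn}_{P^\circ}(B)=\{y\in\mathbb{R}^n : \exists w\in K^*,\ \mathbb{1}-V^*(y)-B^*(w)\in\mathcal{O}_{in}^v\}$, $\mathrm{Out}_{P^\circ}(A)=\{H(p) : p\in\mathcal{O}_{out}^f,\ \mathbb{1}^Tp\le 1,\ A(p)\in K^*\}$. *)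

(* Defs.v *)
From HB Require Import structures.
From mathcomp Require Import all_boot all_order all_algebra.
From mathcomp Require Import all_classical all_reals all_analysis.

Set Implicit Arguments.
Unset Strict Implicit.
Unset Printing Implicit Defensive.

Import Order.TTheory GRing.Theory Num.Theory.
Import numFieldNormedType.Exports.

Local Open Scope classical_set_scope.
Local Open Scope ring_scope.

(* R^n is 'cV[R]_n and a linear map R^k -> R^m is its matrix in 'M[R]_(m, k),
   with the transpose as adjoint. The norm that the library puts on matrices is
   the sup norm; it induces the usual topology, which is all that is used of it
   here. The Euclidean norm is [enorm]. *)

Section Euclidean.
Variable R : realType.

Definition dot n (x y : 'cV[R]_n) : R := \sum_i x i 0 * y i 0.

Definition enorm n (x : 'cV[R]_n) : R := Num.sqrt (dot x x).

Definition ones n : 'cV[R]_n := const_mx 1.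

Definition nonneg_orthant n : set 'cV[R]_n := [set x | forall i, 0 <= x i 0].

Definition polar n (C : set 'cV[R]_n) : set 'cV[R]_n :=
  [set y | forall x, C x -> dot y x <= 1].

Definition closed_convex_cone m (K : set 'cV[R]_m) : Prop :=
  [/\ closed K, convex_set K, K !=set0 &
      forall (t : R) x, 0 <= t -> K x -> K (t *: x)].

Definition dual_cone m (K : set 'cV[R]_m) : set 'cV[R]_m :=
  [set y | forall x, K x -> 0 <= dot y x].

Definition nonneg_map m k (K : set 'cV[R]_m) (B : 'M[R]_(m, k)) : Prop :=
  forall x, nonneg_orthant x -> K (B *m x).

End Euclidean.

Section Polytopes.
Variables (R : realType) (n : nat).
Implicit Types (P F : set 'cV[R]_n).

Definition hpolyhedron f (H : 'M[R]_(n, f)) : set 'cV[R]_n :=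
  [set x | forall i, (H^T *m x) i 0 <= 1].

Definition is_polytope P : Prop :=
  exists (k : nat) (M : 'M[R]_(n, k)),
    P = [set M *m l | l in [set l | nonneg_orthant l /\ dot (ones R k) l = 1]].

(* For nonempty [P], the dimension of its affine hull, i.e., of the least
   linear subspace [U] that contains all differences of points of [P]. The
   empty set (of dimension -1) is related to no [d]. *)
Definition has_affdim P (d : nat) : Prop :=
  P !=set0 /\
  exists U : {vspace 'cV[R]_n},
    [/\ forall x y, P x -> P y -> x - y \in U,
        forall W : {vspace 'cV[R]_n},
          (forall x y, P x -> P y -> x - y \in W) -> (U <= W)%VS
      & \dim U = d].

Definition full_dimensional P : Prop := has_affdim P n.

Definition is_face P F : Prop :=
  exists (c : 'cV[R]_n) (b : R),
    (forall x, P x -> dot c x <= b) /\ F = P `&` [set x | dot c x = b].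

Definition is_facet P F : Prop :=
  is_face P F /\ exists2 d, has_affdim P d.+1 & has_affdim F d.

Definition is_vertex P (p : 'cV[R]_n) : Prop := is_face P [set p].

(* The inequalities <h_i, x> <= 1, for h_i the columns of [H], are valid for
   [P] and define its facets, one inequality for each facet. *)
Definition facet_matrix P f (H : 'M[R]_(n, f)) : Prop :=
  let F i := P `&` [set x | dot (col i H) x = 1] in
  [/\ forall i x, P x -> dot (col i H) x <= 1,
      forall i, is_facet P (F i)
    & forall G, is_facet P G -> exists! i, G = F i].

Definition vertex_matrix P v (V : 'M[R]_(n, v)) : Prop :=
  (forall j, is_vertex P (col j V)) /\
  (forall p, is_vertex P p -> exists! j, p = col j V).

End Polytopes.

Section Approximations.
Variable R : realType.

(* [k%:R - 1] is a subtraction in [R]; for k = 0 the square root is 0 and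
   [O_in 0] is the whole of R^0. *)
Definition O_in k : set 'cV[R]_k :=
  [set x | Num.sqrt (k%:R - 1) * enorm x <= dot (ones R k) x].

Definition O_out k : set 'cV[R]_k :=
  [set x | enorm x <= dot (ones R k) x].

(* The polytope enters [Inn] only through the matrix [H] of its facet normals,
   and [Out] only through the matrix [V] of its vertices. For P itself,
     Inn_P(A) = Inn H K A   and   Out_P(B) = Out V K B.
   The facet normals of the polar of P are the vertices of P and conversely, so
     Inn_{P°}(B) = Inn V (dual_cone K) B   and
     Out_{P°}(A) = Out H (dual_cone K) A. *)
Definition Inn n m f (H : 'M[R]_(n, f)) (K : set 'cV[R]_m) (A : 'M[R]_(m, f)) :
    set 'cV[R]_n :=
  [set x | exists2 y, K y & @O_in f (ones R f - H^T *m x - A^T *m y)].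

Definition Out n m v (V : 'M[R]_(n, v)) (K : set 'cV[R]_m) (B : 'M[R]_(m, v)) :
    set 'cV[R]_n :=
  [set V *m z | z in [set z | [/\ @O_out v z, dot (ones R v) z <= 1
                                & K (B *m z)]]].

End Approximations.

(* Main.v *)
(* The cones [O_in] and [O_out] are dual to each other, which gives <x, y> <= 1
   for x in Out and y in Inn directly. Conversely, let <H p, x> <= 1 for all
   H p in Out. Then 1 - H^T x is nonnegative on the cone of all p in O_out with
   A p in the dual of K, so it lies in the closure of O_in + A^T K. The vector 1
   is interior to O_in, so 1 + e - H^T x lies in O_in + A^T K itself and
   x / (1 + e) is in Inn, for all e > 0. For the first equation, separate a point
   from the compact convex set Out and let e tend to 0 in the value of the
   separating functional; for the second, let e tend to 0 in the closed set Inn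
   and use K** = K. *)
Require Import Defs.
From mathcomp Require Import all_boot all_order all_algebra.
From mathcomp Require Import ring lra.
From mathcomp Require Import all_classical all_reals all_analysis.
Import Order.TTheory GRing.Theory Num.Theory.
Import numFieldNormedType.Exports.

Set Implicit Arguments.
Unset Strict Implicit.
Unset Printing Implicit Defensive.

Local Open Scope classical_set_scope.
Local Open Scope ring_scope.

(** * Inner product algebra and the Cauchy-Schwarz inequality *)

Section InnerProduct.
Context {R : realType}.

Lemma dotE n (x y : 'cV[R]_n) : dot x y = (x^T *m y) 0 0.
Proof. by rewrite mxE; apply: eq_bigr => i _; rewrite mxE. Qed.

Lemma dotC n (x y : 'cV[R]_n) : dot x y = dot y x.
Proof. by apply: eq_bigr => i _; rewrite mulrC. Qed.

Lemma dotDr n (z x y : 'cV[R]_n) : dot z (x + y) = dot z x + dot z y.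
Proof. by rewrite !dotE mulmxDr mxE. Qed.

Lemma dotZr n a (z x : 'cV[R]_n) : dot z (a *: x) = a * dot z x.
Proof. by rewrite !dotE -scalemxAr mxE. Qed.

Lemma dotDl n (z x y : 'cV[R]_n) : dot (x + y) z = dot x z + dot y z.
Proof. by rewrite -!(dotC z) dotDr. Qed.

Lemma dotZl n a (z x : 'cV[R]_n) : dot (a *: x) z = a * dot x z.
Proof. by rewrite -!(dotC z) dotZr. Qed.

Lemma dotNr n (z x : 'cV[R]_n) : dot z (- x) = - dot z x.
Proof. by rewrite -scaleN1r dotZr mulN1r. Qed.

Lemma dotNl n (z x : 'cV[R]_n) : dot (- x) z = - dot x z.
Proof. by rewrite -!(dotC z) dotNr. Qed.

Definition dot_linear := (dotDl, dotDr, dotNl, dotNr, dotZl, dotZr).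

Lemma dot0r n (x : 'cV[R]_n) : dot x 0 = 0.
Proof. by rewrite -(scale0r x) dotZr mul0r. Qed.

Lemma dot_mulmx m n (M : 'M[R]_(m, n)) x y : dot (M *m x) y = dot x (M^T *m y).
Proof. by rewrite !dotE trmx_mul mulmxA. Qed.

Lemma dot_ge0 n (x : 'cV[R]_n) : 0 <= dot x x.
Proof. by apply: sumr_ge0 => i _; rewrite -expr2 sqr_ge0. Qed.

Lemma dot_eq0 n (x : 'cV[R]_n) : dot x x = 0 -> x = 0.
Proof.
move=> xx0; apply/colP => i; rewrite mxE; apply/eqP; rewrite -sqrf_eq0 expr2.
by rewrite (psumr_eq0P _ xx0)// => j _; rewrite -expr2 sqr_ge0.
Qed.

Lemma coord_le_dot n (x : 'cV[R]_n) i : x i 0 ^+ 2 <= dot x x.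
Proof.
by rewrite /dot (bigD1 i)//= expr2 lerDl sumr_ge0// => j _; rewrite -expr2 sqr_ge0.
Qed.

Lemma cauchy_schwarz n (x y : 'cV[R]_n) : dot x y ^+ 2 <= dot x x * dot y y.
Proof.
have [yy0|yy_gt0] := eqVneq (dot y y) 0.
  by rewrite (dot_eq0 yy0) !dot0r mulr0 expr0n.
(* The squared norm of this vector is [dot y y] times [dot x x * dot y y - dot x y ^+ 2]. *)
have := dot_ge0 (dot y y *: x - dot x y *: y).
rewrite !dot_linear (dotC y x) => h.
have {}yy_gt0 : 0 < dot y y by rewrite lt_neqAle eq_sym yy_gt0 dot_ge0.
rewrite -(ler_pM2l yy_gt0); nra.
Qed.

Lemma dot_ones n : dot (ones R n) (ones R n) = n%:R.
Proof.
rewrite /dot (eq_bigr (fun=> 1)); last by move=> i _; rewrite mxE mulr1.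
by rewrite sumr_const card_ord.
Qed.

Lemma enorm_le n (x : 'cV[R]_n) a : (enorm x <= a) = (0 <= a) && (dot x x <= a ^+ 2).
Proof.
rewrite /enorm; have [a_ge0|a_lt0] /= := leP 0 a; last first.
  by apply/negbTE; rewrite -ltNge (lt_le_trans a_lt0)// sqrtr_ge0.
by rewrite -[in LHS](ger0_norm a_ge0) -sqrtr_sqr ler_sqrt ?sqr_ge0.
Qed.

End InnerProduct.

(** * Duality of the cones [O_in] and [O_out] *)

Section Cones.
Context {R : realType}.

Lemma dot_dim0 (x y : 'cV[R]_0) : dot x y = 0.
Proof. by rewrite /dot big_ord0. Qed.

Lemma O_inP k (x : 'cV[R]_k) :
  O_in x <-> 0 <= dot (ones R k) x /\ (k%:R - 1) * dot x x <= dot (ones R k) x ^+ 2.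
Proof.
(* For [k = 0] the factor [k%:R - 1] is negative, which blocks the product rule for square roots;
   there all inner products vanish. *)
rewrite /O_in/=; case: k x => [|k] x.
  by rewrite /enorm !dot_dim0 sqrtr0 !mulr0 expr0n.
have k_ge0 : 0 <= k.+1%:R - 1 :> R by rewrite subr_ge0 ler1n.
rewrite -sqrtrM//.
have [a_ge0|a_lt0] := leP 0 (dot (ones R k.+1) x); last first.
  split=> [h|[]//].
  by have := le_lt_trans (le_trans (sqrtr_ge0 _) h) a_lt0; rewrite ltxx.
by rewrite -[in X in X <-> _](ger0_norm a_ge0) -sqrtr_sqr ler_sqrt ?sqr_ge0//; split=> [|[]].
Qed.

Lemma O_outP k (x : 'cV[R]_k) :
  O_out x <-> 0 <= dot (ones R k) x /\ dot x x <= dot (ones R k) x ^+ 2.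
Proof. by rewrite /O_out/= enorm_le; split=> /andP. Qed.

Lemma O_in0 k : O_in (0 : 'cV[R]_k).
Proof. by apply/O_inP; rewrite !dot0r mulr0 expr0n. Qed.

Lemma O_out0 k : O_out (0 : 'cV[R]_k).
Proof. by apply/O_outP; rewrite !dot0r expr0n. Qed.

Lemma O_inZ k (t : R) (x : 'cV[R]_k) : 0 <= t -> O_in x -> O_in (t *: x).
Proof.
move=> t_ge0 /O_inP[a_ge0 xa]; apply/O_inP.
by rewrite !dot_linear; split; [exact: mulr_ge0 | nra].
Qed.

Lemma O_outZ k (t : R) (x : 'cV[R]_k) : 0 <= t -> O_out x -> O_out (t *: x).
Proof.
move=> t_ge0 /O_outP[a_ge0 xa]; apply/O_outP.
by rewrite !dot_linear; split; [exact: mulr_ge0 | nra].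
Qed.

Lemma ler_of_sqr (a b : R) : 0 <= b -> a ^+ 2 <= b ^+ 2 -> a <= b.
Proof. by move=> b_ge0 ab; rewrite leNgt; apply/negP => ba; nra. Qed.

(** Expanding the squared inequality leaves the cross term [(k - 1) <x, y> <= <1, x> <1, y>], which
    follows from Cauchy-Schwarz and the product of the two cone inequalities. *)
Lemma O_inD k (x y : 'cV[R]_k) : O_in x -> O_in y -> O_in (x + y).
Proof.
case: k x y => [|k] x y; first by rewrite [x]flatmx0 add0r.
move=> /O_inP[a_ge0 xa] /O_inP[b_ge0 yb]; apply/O_inP.
rewrite !dot_linear; split; first exact: addr_ge0.
have k_ge0 : 0 <= k.+1%:R - 1 :> R by rewrite subr_ge0 ler1n.
have := cauchy_schwarz x y; rewrite (dotC y x).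
have := dot_ge0 x; have := dot_ge0 y.
move: (dot _ x) (dot _ y) (dot x x) (dot y y) (dot x y) (_ - 1) a_ge0 b_ge0 xa yb k_ge0.
move=> a b xx yy xy c a_ge0 b_ge0 xa yb c_ge0 yy_ge0 xx_ge0 cs.
suff : c * xy <= a * b by nra.
apply: ler_of_sqr; first exact: mulr_ge0.
rewrite !exprMn (le_trans (ler_wpM2l (sqr_ge0 c) cs))//.
have -> : c ^+ 2 * (xx * yy) = (c * xx) * (c * yy) by ring.
by rewrite ler_pM// mulr_ge0.
Qed.

Lemma O_outD k (x y : 'cV[R]_k) : O_out x -> O_out y -> O_out (x + y).
Proof.
move=> /O_outP[a_ge0 xa] /O_outP[b_ge0 yb]; apply/O_outP.
rewrite !dot_linear; split; first exact: addr_ge0.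
have := cauchy_schwarz x y; rewrite (dotC y x) => cs.
suff : dot x y <= dot (ones R k) x * dot (ones R k) y by nra.
apply: ler_of_sqr; first exact: mulr_ge0.
by rewrite exprMn (le_trans cs)// ler_pM// dot_ge0.
Qed.

(* The ball is that of radius e around e * 1, which touches the coordinate
   hyperplanes; the constant sqrt(k - 1) in O_in is the one that makes it fit. *)
Lemma ball_ones_O_in k (e : R) (d : 'cV[R]_k) :
  0 <= e -> dot d d <= e ^+ 2 -> O_in (e *: ones R k + d).
Proof.
case: k d => [|k] d; first by rewrite [_ + _]flatmx0 => _ _; exact: O_in0.
move=> e_ge0 de; apply/O_inP.
rewrite !dot_linear (dotC d) dot_ones.
have k_ge1 : 1 <= k.+1%:R :> R by rewrite ler1n.
have := cauchy_schwarz (ones R k.+1) d; rewrite dot_ones.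
have := dot_ge0 d.
move: (dot _ d) (dot d d) (k.+1%:R) k_ge1 de => a dd c c_ge1 de dd_ge0 cs.
split; last first.
  have : (c - 1) * dd <= (c - 1) * e ^+ 2 by rewrite ler_wpM2l// subr_ge0.
  (* Once [dd] is replaced by its bound [e ^+ 2], the two sides differ by exactly [(e + a) ^+ 2]. *)
  have := sqr_ge0 (e + a); nra.
suff : - a <= e * c by lra.
apply: ler_of_sqr; first by rewrite mulr_ge0//; lra.
rewrite sqrrN (le_trans cs)// exprMn.
have : c * dd <= c * e ^+ 2 by rewrite ler_wpM2l//; lra.
have : c * e ^+ 2 <= c * (c * e ^+ 2).
  by rewrite ler_peMl// mulr_ge0 ?sqr_ge0//; lra.
by lra.
Qed.

(** For [k > 0] both are circular cones around the axis 1, with squared cosines of the half-angles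
    [1 / k] for [O_out] and [(k - 1) / k] for [O_in]. These add up to 1, so the half-angles are
    complementary. *)
Lemma dot_O_out_O_in k (p s : 'cV[R]_k) : O_out p -> O_in s -> 0 <= dot p s.
Proof.
case: k p s => [|k] p s; first by rewrite dot_dim0.
move=> /O_outP[a_ge0 pa] /O_inP[b_ge0 sb].
(* Cauchy-Schwarz for the components of p and s orthogonal to 1, scaled by
   k + 1. *)
have := cauchy_schwarz (k.+1%:R *: p - dot (ones R k.+1) p *: ones R k.+1)
                       (k.+1%:R *: s - dot (ones R k.+1) s *: ones R k.+1).
rewrite !dot_linear !dot_ones (dotC p (ones R _)) (dotC s (ones R _)).
have k_ge1 : 1 <= k.+1%:R :> R by rewrite ler1n.
have := cauchy_schwarz (ones R k.+1) s; rewrite dot_ones -subr_ge0.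
move: (dot _ p) (dot _ s) (dot p p) (dot s s) (dot p s) (k.+1%:R) a_ge0 b_ge0 pa sb k_ge1.
move=> a b pp ss ps c a_ge0 b_ge0 pa sb c_ge1 h3 cs.
have c_gt0 : 0 < c by lra.
have cs' : (c * ps - a * b) ^+ 2 <= (c * pp - a ^+ 2) * (c * ss - b ^+ 2).
  rewrite -(ler_pM2l (exprn_gt0 2 c_gt0)).
  by apply: le_trans (le_trans _ cs) _; rewrite le_eqVlt; apply/orP; left; apply/eqP; ring.
have h1 : c * pp - a ^+ 2 <= (c - 1) * a ^+ 2.
  by have : c * pp <= c * a ^+ 2 by [rewrite ler_pM2l]; lra.
have h2 : (c - 1) * (c * ss - b ^+ 2) <= b ^+ 2.
  by have : c * ((c - 1) * ss) <= c * b ^+ 2 by [rewrite ler_pM2l]; lra.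
have : (c * ps - a * b) ^+ 2 <= (a * b) ^+ 2.
  rewrite exprMn (le_trans cs')// (le_trans (ler_wpM2r h3 h1))//.
  by rewrite mulrAC mulrC ler_wpM2l ?sqr_ge0.
(* [ler_of_sqr] only bounds from above; applied to the negated base it yields [0 <= c * ps]. *)
rewrite -sqrrN => /(ler_of_sqr (mulr_ge0 a_ge0 b_ge0)) h4.
by rewrite -(pmulr_rge0 _ c_gt0); lra.
Qed.

Lemma dual_O_in_sub_O_out k (p : 'cV[R]_k) :
  (forall s, O_in s -> 0 <= dot p s) -> O_out p.
Proof.
case: k p => [|k] p; first by rewrite [p]flatmx0 => _; exact: O_out0.
move=> p_dual.
pose c : R := k.+1%:R; pose a := dot (ones R k.+1) p.
have c_ge1 : 1 <= c by rewrite ler1n.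
have a_ge0 : 0 <= a.
  rewrite /a dotC; apply: p_dual; rewrite -[ones R _]scale1r -[_ *: _]addr0.
  by apply: ball_ones_O_in; rewrite // dot0r expr1n.
(* The test vector t * 1 - q is a boundary point of O_in. *)
pose q := c *: p - a *: ones R k.+1.
have q1 : dot (ones R k.+1) q = 0.
  by rewrite /q !dot_linear dot_ones -/a -/c; ring.
have qq : dot q q = c * (c * dot p p - a ^+ 2).
  by rewrite /q !dot_linear dot_ones (dotC p) -/a -/c; ring.
have pq : dot p q = c * dot p p - a ^+ 2.
  by rewrite /q !dot_linear (dotC p) -/a; ring.
clearbody q; set X := c * dot p p - a ^+ 2 in qq pq.
have X_ge0 : 0 <= X by rewrite -(pmulr_rge0 _ (lt_le_trans ltr01 c_ge1)) -qq dot_ge0.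
pose t := Num.sqrt ((c - 1) * X).
have t2 : t ^+ 2 = (c - 1) * X.
  by rewrite sqr_sqrtr// mulr_ge0//; lra.
have t_ge0 : 0 <= t by exact: sqrtr_ge0.
have /p_dual : O_in (t *: ones R k.+1 - q).
  apply/O_inP; rewrite !dot_linear (dotC q) q1 qq dot_ones -/c.
  split; first by rewrite oppr0 addr0 mulr_ge0//; lra.
  have -> : (t * c - 0) ^+ 2 = c ^+ 2 * t ^+ 2 by ring.
  rewrite -[leLHS]/((c - 1) * _).
  have -> : t * (t * c) - t * 0 + (- (t * 0) - - (c * X)) = c * t ^+ 2 + c * X by ring.
  by rewrite t2 le_eqVlt; apply/orP; left; apply/eqP; ring.
rewrite !dot_linear (dotC p) -/a pq => tq.
apply/O_outP; split=> //; rewrite -/a.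
rewrite -(ler_pM2l (lt_le_trans ltr01 c_ge1)).
(* The test vector gives [X <= t * a]. Squaring this and cancelling one factor [X] proves the claim,
   so [X = 0] is treated apart. *)
suff : X <= (c - 1) * a ^+ 2 by rewrite /X; lra.
have [->|X_neq0] := eqVneq X 0; first by rewrite mulr_ge0 ?sqr_ge0//; lra.
have X_gt0 : 0 < X by rewrite lt_neqAle eq_sym X_neq0.
rewrite -(ler_pM2l X_gt0).
have -> : X * ((c - 1) * a ^+ 2) = (t * a) ^+ 2 by rewrite exprMn t2; ring.
by rewrite -expr2 ler_pXn2r// ?nnegrE ?mulr_ge0//; lra.
Qed.
End Cones.

(** * Continuity, compactness, nearest points and separation *)

Section Topology.
Context {R : realType}.

Lemma mx_continuous (T : topologicalType) m n (f : T -> 'M[R]_(m, n)) :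
  (forall i j, continuous (fun x => f x i j)) -> continuous f.
Proof.
move=> cf x A [P fxP PA].
suff : \forall y \near x, forall i j, P i j (f y i j).
  by apply: filterS => y yP; apply: PA => i j; exact: yP.
by apply: filter_forall => i; apply: filter_forall => j; exact: cf (fxP i j).
Qed.

Lemma sum_continuous (T : topologicalType) n (f : 'I_n -> T -> R) :
  (forall i, continuous (f i)) -> continuous (fun x => \sum_i f i x).
Proof.
move=> cf x; rewrite /continuous_at.
by apply: (@cvg_big _ _ +%R) => [|i _]; [exact: add_continuous|exact: cf].
Qed.

Lemma dot_continuous (T : topologicalType) n (f g : T -> 'cV[R]_n) :
  continuous f -> continuous g -> continuous (fun x => dot (f x) (g x)).
Proof.
move=> cf cg; apply: sum_continuous => i x; apply: cvgM.
- by apply: (@continuous_comp _ _ _ f (fun M : 'cV_n => M i 0)); [exact: cf|exact: coord_continuous].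
- by apply: (@continuous_comp _ _ _ g (fun M : 'cV_n => M i 0)); [exact: cg|exact: coord_continuous].
Qed.

Lemma cst_continuous (T U : topologicalType) (u : U) : continuous (fun _ : T => u).
Proof. by move=> x; exact: cvg_cst. Qed.

Lemma mulmx_continuous m n (M : 'M[R]_(m, n)) :
  continuous (fun x : 'cV[R]_n => M *m x).
Proof.
apply: mx_continuous => i j.
have -> : (fun x : 'cV[R]_n => (M *m x) i j) = (fun x => dot (col i M^T) x).
  by apply/funext => x; rewrite mxE ord1; apply: eq_bigr => k _; rewrite !mxE.
by apply: dot_continuous; [exact: cst_continuous|move=> ?; exact: cvg_id].
Qed.

(** Heine-Borel for row vectors, carried over by the continuous map [trmx]. *)
Lemma cV_bounded_closed_compact n (A : set 'cV[R]_n) (M : R) :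
  (forall x i, A x -> `|x i 0| <= M) -> closed A -> compact A.
Proof.
move=> AM clA.
have ctr : continuous (trmx : 'rV[R]_n -> 'cV[R]_n).
  apply: mx_continuous => i j.
  under eq_fun do rewrite mxE; exact: coord_continuous.
have -> : A = trmx @` (trmx @^-1` A).
  by rewrite image_preimage// eqEsubset; split=> // x _; exists x^T => //; rewrite trmxK.
apply: continuous_compact; first exact: continuous_subspaceT.
apply: bounded_closed_compact; last by apply: preimage_closed => // x _; exact: ctr.
exists (Num.max 0 M); split; first exact: num_real.
move=> r Mr x Ax; rewrite /= [leLHS]/Num.norm/= mx_normrE.
move: Mr; rewrite gt_max => /andP[r_gt0 Mr].
apply/bigmax_leP; split; first exact: ltW.
move=> [i j] _ /=; rewrite ord1; apply: le_trans (ltW Mr).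
by have := AM _ j Ax; rewrite mxE.
Qed.

Lemma nearest_point n (C : set 'cV[R]_n) (z : 'cV[R]_n) : closed C -> C !=set0 ->
  exists2 c, C c & forall x, C x -> dot (z - c) (z - c) <= dot (z - x) (z - x).
Proof.
move=> clC [x0 Cx0].
pose q (x : 'cV[R]_n) := dot (z - x) (z - x).
have cq : continuous q.
  have cs : continuous (fun x : 'cV[R]_n => z - x).
    by move=> x; apply: (@continuousB R 'cV[R]_n _ (fun=> z) id); [exact: cst_continuous|move=> ?].
  exact: dot_continuous.
(* [C] may be unbounded; the minimum is sought among the points at least as near to [z] as [x0]. *)
pose D := C `&` [set x | q x <= q x0].
have D_compact : compact D.
  (* The summand [1 + q x0] bounds [|z_i - x_i|] because [s <= 1 + s ^+ 2]; the sum over [j] bounds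
     [|z_i|] uniformly in [i]. *)
  apply: (@cV_bounded_closed_compact _ _ (\sum_j `|z j 0| + 1 + q x0)).
    move=> x i [_ /= qx].
    have := coord_le_dot (z - x) i; rewrite -/(q x) !mxE => /le_trans/(_ qx) h.
    have h1 : `|z i 0 - x i 0| <= 1 + q x0.
      have := sqr_ge0 (`|z i 0 - x i 0| - 1).
      have := sqr_ge0 (`|z i 0 - x i 0|).
      have := real_normK (num_real (z i 0 - x i 0)); nra.
    have h2 : `|z i 0| <= \sum_j `|z j 0|.
      by rewrite (bigD1 i)//= lerDl sumr_ge0.
    have -> : x i 0 = z i 0 - (z i 0 - x i 0) by ring.
    by rewrite (le_trans (ler_normB _ _))//; lra.
  apply: closedI => //.
  apply: (@preimage_closed _ _ q [set r | r <= q x0]); last exact: closed_le.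
  by move=> x _; exact: cq.
have [||c] := @compact_EVT_min _ _ q D _ D_compact.
- by exists x0; split=> /=.
- exact: continuous_subspaceT.
rewrite inE => -[Cc qc] cmin; exists c => // x Cx.
have [qx|/ltW qx] := leP (q x) (q x0); first by apply: cmin; rewrite inE.
exact: le_trans qc qx.
Qed.

(** The normal is [z - c] for the point [c] of [C] nearest to [z]: a point of [C] beyond the
    hyperplane through [c] would allow a step from [c] that comes closer to [z]. *)
Lemma strict_separation n (C : set 'cV[R]_n) (z : 'cV[R]_n) :
  closed C -> C !=set0 ->
  (forall x y t, C x -> C y -> 0 <= t <= 1 -> C (x + t *: (y - x))) -> ~ C z ->
  exists u c, (forall x, C x -> dot u x <= c) /\ c < dot u z.
Proof.
move=> clC C0 cvC Cz; have [c Cc cmin] := nearest_point z clC C0.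
exists (z - c), (dot (z - c) c).
have zc_gt0 : 0 < dot (z - c) (z - c).
  rewrite lt_neqAle dot_ge0 andbT eq_sym; apply/eqP => /dot_eq0/eqP.
  by rewrite subr_eq0 => /eqP zc; apply: Cz; rewrite zc.
split; last by rewrite -subr_gt0 -dotNr -dotDr.
move=> x Cx; rewrite -subr_le0 -dotNr -dotDr leNgt; apply/negP => h.
set a := dot (z - c) (x - c) in h.
pose b := dot (x - c) (x - c).
have b_ge0 : 0 <= b := dot_ge0 _.
(* This step length lies in [0, 1] and changes the squared distance by
   [- 2 t a + t ^+ 2 b = - t a (1 + t)], which is negative. *)
pose t := a / (a + b).
have ab_gt0 : 0 < a + b by lra.
have t01 : 0 <= t <= 1.
  by rewrite divr_ge0 ?(ltW h) ?(ltW ab_gt0)//= ler_pdivrMr//; lra.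
have t_gt0 : 0 < t by exact: divr_gt0.
have := cmin _ (cvC _ _ _ Cc Cx t01).
have -> : z - (c + t *: (x - c)) = (z - c) + - (t *: (x - c)).
  by rewrite opprD addrA.
move: (z - c) (x - c) @a @b h b_ge0 => u w a b h b_ge0 in t ab_gt0 t01 t_gt0 *.
rewrite !(dotDl, dotDr u, dotDr w, dotNl, dotNr, dotZl, dotZr) (dotC w) -/a -/b.
have tab : t * (a + b) = a by rewrite divfK// gt_eqF.
nra.
Qed.

Lemma cone_separation n (C : set 'cV[R]_n) (z : 'cV[R]_n) :
  closed C -> C !=set0 -> (forall x y, C x -> C y -> C (x + y)) ->
  (forall t x, 0 <= t -> C x -> C (t *: x)) -> ~ C z ->
  exists2 u, dual_cone C u & dot u z < 0.
Proof.
move=> clC C0 CD CZ Cz.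
have Cconv x y t : C x -> C y -> 0 <= t <= 1 -> C (x + t *: (y - x)).
  move=> Cx Cy /andP[t0 t1].
  have -> : x + t *: (y - x) = (1 - t) *: x + t *: y.
    by rewrite scalerBl scale1r scalerBr -addrA [- _ + _]addrC.
  by apply: CD; apply: CZ => //; lra.
have [u [c [uC uz]]] := strict_separation clC C0 Cconv Cz.
have c_ge0 : 0 <= c.
  by have [x Cx] := C0; have := uC _ (CZ 0 _ (lexx _) Cx); rewrite scale0r dot0r.
exists (- u); last by rewrite dotNl; lra.
move=> x Cx; rewrite dotNl oppr_ge0 leNgt; apply/negP => ux.
(* Scaled by this factor, [x] takes the value [c + 1] under [u], above the bound [c]. *)
have t_ge0 : 0 <= (c + 1) / dot u x by rewrite divr_ge0 ?(ltW ux)//; lra.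
have := uC _ (CZ _ _ t_ge0 Cx); rewrite dotZr divfK ?gt_eqF//; lra.
Qed.

End Topology.

(** * Approximate membership in [Inn], closedness of [Out], and polarity *)

Section Duality.
Context {R : realType}.

(** A sum is twice a midpoint, so convexity at 1/2 and scaling by 2 suffice. *)
Lemma closed_convex_coneD m (K : set 'cV[R]_m) x y :
  closed_convex_cone K -> K x -> K y -> K (x + y).
Proof.
move=> [_ Kconv _ KZ] Kx Ky.
have h : 0 <= (2^-1 : R) <= 1 by apply/andP; split; lra.
have := Kconv x y (Itv01 (andP h).1 (andP h).2).
rewrite !inE => /(_ Kx Ky) Kxy.
have -> : x + y = 2 *: (2^-1 *: x + (1 - 2^-1) *: y).
  by apply/colP => i; rewrite !mxE; field.
exact: KZ.
Qed.

Lemma dual_coneD m (K : set 'cV[R]_m) x y :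
  dual_cone K x -> dual_cone K y -> dual_cone K (x + y).
Proof. by move=> Kx Ky z Kz; rewrite dotDl addr_ge0 ?Kx ?Ky. Qed.

Lemma dual_coneZ m (K : set 'cV[R]_m) t x :
  0 <= t -> dual_cone K x -> dual_cone K (t *: x).
Proof. by move=> t_ge0 Kx z Kz; rewrite dotZl mulr_ge0 ?Kx. Qed.

Lemma dual_cone0 m (K : set 'cV[R]_m) : dual_cone K 0.
Proof. by move=> z _; rewrite dotC dot0r. Qed.

Lemma dual_cone_closed m (K : set 'cV[R]_m) : closed (dual_cone K).
Proof.
have -> : dual_cone K = \bigcap_(x in K) ((fun y : 'cV[R]_m => dot y x) @^-1` [set r | 0 <= r]).
  by apply/seteqP; split=> y.
apply: closed_bigI => x Kx; apply: preimage_closed; last exact: closed_ge.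
move=> y _; apply: (@dot_continuous _ _ _ id (fun=> x)); last exact: cst_continuous.
by move=> ?.
Qed.

Lemma O_out_closed k : closed (@O_out R k).
Proof.
have -> : @O_out R k = dual_cone (@O_in R k).
  by apply/seteqP; split=> p; [move=> pO s; exact: dot_O_out_O_in|exact: dual_O_in_sub_O_out].
exact: dual_cone_closed.
Qed.

(** A conic Farkas lemma with slack [e]: the cone [O_in + A^T K] may fail to be closed, so [w]
    itself need not lie in it. *)
Lemma O_in_dual_approx k m (K : set 'cV[R]_m) (A : 'M[R]_(m, k)) (w : 'cV[R]_k) (e : R) :
  K 0 -> (forall x y, K x -> K y -> K (x + y)) ->
  (forall t x, 0 <= t -> K x -> K (t *: x)) ->
  (forall p, O_out p -> dual_cone K (A *m p) -> 0 <= dot p w) ->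
  0 < e -> exists2 y, K y & O_in (w + e *: ones R k - A^T *m y).
Proof.
move=> K0 KD KZ wA e_gt0.
(* As 1 is interior to O_in, N is the closure of O_in + A^T K. *)
pose N := [set x | forall d : R, 0 < d -> exists2 y, K y & O_in (x + d *: ones R k - A^T *m y)].
suff : N w by exact.
have N_in s : O_in s -> N s.
  move=> sO d d_gt0; exists 0 => //; rewrite mulmx0 subr0; apply: O_inD => //.
  rewrite -[_ *: _]addr0; apply: ball_ones_O_in; first exact: ltW.
  by rewrite dot0r sqr_ge0.
have N_A y : K y -> N (A^T *m y).
  move=> Ky d d_gt0; exists y => //; rewrite addrAC subrr add0r.
  rewrite -[_ *: _]addr0; apply: ball_ones_O_in; first exact: ltW.
  by rewrite dot0r sqr_ge0.
have ND x y : N x -> N y -> N (x + y).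
  move=> Nx Ny d d_gt0.
  have d2_gt0 : 0 < d / 2 by rewrite divr_gt0.
  have [a Ka xa] := Nx _ d2_gt0; have [b Kb yb] := Ny _ d2_gt0.
  exists (a + b); first exact: KD.
  have := O_inD xa yb; congr O_in.
  by rewrite mulmxDr; apply/colP => i; rewrite !mxE; field.
have NZ t x : 0 <= t -> N x -> N (t *: x).
  move=> t_ge0 Nx; have [->|t_neq0] := eqVneq t 0.
    by rewrite scale0r; exact: (N_in _ (O_in0 _)).
  have t_gt0 : 0 < t by rewrite lt_neqAle eq_sym t_neq0.
  move=> d d_gt0; have [y Ky xy] := Nx _ (divr_gt0 d_gt0 t_gt0).
  exists (t *: y); first exact: KZ.
  have := O_inZ t_ge0 xy; congr O_in.
  by rewrite scalerBr scalerDr scalerA mulrC divfK// scalemxAr.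
have N_closed : closed N.
  move=> x xN d d_gt0.
  (* Half of [d] is spent on [x'], half on absorbing [x - x']. The ball is that of the sup norm, so
     [x - x'] has squared Euclidean norm at most [k r ^+ 2]; dividing by [k + 1] keeps this below
     [(d / 2) ^+ 2] and covers [k = 0]. *)
  pose r : R := (d / 2) / k.+1%:R.
  have r_gt0 : 0 < r by rewrite !divr_gt0.
  have [x' [Nx' xx']] := xN _ (nbhsx_ballx x r r_gt0).
  have [|y Ky yO] := Nx' (d / 2); first by rewrite divr_gt0.
  exists y => //.
  have bO : O_in ((d / 2) *: ones R k + (x - x')).
    apply: ball_ones_O_in; first by rewrite divr_ge0 ?ltW.
    apply: (@le_trans _ _ (\sum_(i < k) r ^+ 2)).
      apply: ler_sum => i _; rewrite -expr2 -real_normK ?num_real//.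
      rewrite ler_pXn2r ?nnegrE ?normr_ge0 ?(ltW r_gt0)// ltW//.
      by case: xx' => _ /(_ i 0); rewrite -ball_normE/= !mxE.
    rewrite sumr_const card_ord.
    have -> : d / 2 = r * k.+1%:R by rewrite divfK.
    clearbody r.
    rewrite -(mulr_natr (r ^+ 2) k) exprMn ler_wpM2l ?sqr_ge0// -natrX ler_nat.
    by rewrite (leq_trans (leqnSn k))// leq_pmulr.
  have := O_inD yO bO; congr O_in.
  by apply/colP => i; rewrite !mxE; field.
have N0 : N !=set0 by exists 0; exact: (N_in _ (O_in0 _)).
apply: contrapT => Nw.
have [p pN pw] := cone_separation N_closed N0 ND NZ Nw.
suff : 0 <= dot p w by rewrite leNgt pw.
(* [N] contains both [O_in] and [A^T K], so [p] in the dual of [N] satisfies both premises of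
   [wA]. *)
apply: wA; first by apply: dual_O_in_sub_O_out => s sO; exact/pN/N_in.
by move=> y Ky; rewrite dot_mulmx; exact/pN/N_A.
Qed.

(** Dividing by [1 + e] turns the slack [e] in the constant vector into a shrinking of [x]. It
    serves for [K] and for its dual cone alike. *)
Lemma Inn_approx n k m (H : 'M[R]_(n, k)) (K : set 'cV[R]_m) (A : 'M[R]_(m, k)) x (e : R) :
  K 0 -> (forall x y, K x -> K y -> K (x + y)) ->
  (forall t x, 0 <= t -> K x -> K (t *: x)) ->
  polar (Out H (dual_cone K) A) x -> 0 < e ->
  Inn H K A ((1 + e)^-1 *: x).
Proof.
move=> K0 KD KZ xH e_gt0.
have wA p : O_out p -> dual_cone K (A *m p) -> 0 <= dot p (ones R k - H^T *m x).
  move=> pO pA.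
  have [a_ge0 pa] := (O_outP p).1 pO.
  rewrite dotDr dotNr -dot_mulmx (dotC p) subr_ge0.
  (* A point of [O_out] with coordinate sum 0 is 0; any other one can be normalized to sum 1 and
     then yields a point of [Out]. *)
  have [a0|a_neq0] := eqVneq (dot (ones R k) p) 0.
    have -> : p = 0 by apply: dot_eq0; apply/eqP; rewrite eq_le dot_ge0 andbT (le_trans pa)// a0 expr0n.
    by rewrite mulmx0 dotC !dot0r.
  have a_gt0 : 0 < dot (ones R k) p by rewrite lt_neqAle eq_sym a_neq0.
  have ai_gt0 : 0 < (dot (ones R k) p)^-1 by rewrite invr_gt0.
  have ai_ge0 := ltW ai_gt0.
  rewrite -(ler_pM2l ai_gt0) mulVf//.
  rewrite -dotZl dotC; apply: xH; rewrite scalemxAr.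
  exists ((dot (ones R k) p)^-1 *: p) => //; split.
  - exact: O_outZ.
  - by rewrite dotZr mulVf.
  - by rewrite -scalemxAr; exact: dual_coneZ.
have [y Ky yO] := O_in_dual_approx K0 KD KZ wA e_gt0.
have e1_gt0 : 0 < 1 + e by rewrite addr_gt0.
have e1i_ge0 : 0 <= (1 + e)^-1 by rewrite invr_ge0 ltW.
exists ((1 + e)^-1 *: y); first exact: KZ.
have := O_inZ e1i_ge0 yO; congr O_in.
rewrite -!scalemxAr; apply/colP => i; rewrite !mxE; field.
by rewrite gt_eqF.
Qed.

(** Pairing [p] with [1 - H^T y - A^T w] gives [<H p, y> <= <1, p> - <A p, w>], where [<1, p> <= 1]
    and [<A p, w> >= 0]. *)
Lemma dot_Out_Inn n k m (H : 'M[R]_(n, k)) (K L : set 'cV[R]_m) (A : 'M[R]_(m, k)) x y :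
  (forall a b, K a -> L b -> 0 <= dot a b) ->
  Out H K A x -> Inn H L A y -> dot x y <= 1.
Proof.
move=> KL [p [pO p1 Kp] <-] [w Lw yw].
have := dot_O_out_O_in pO yw.
have := KL _ _ Kp Lw; rewrite !dot_mulmx !dotDr !dotNr (dotC p (ones R k)).
lra.
Qed.

(** [Out] is the linear image of a compact set: its parameters satisfy
    [|p_i| <= enorm p <= <1, p> <= 1]. *)
Lemma Out_closed n k m (H : 'M[R]_(n, k)) (K : set 'cV[R]_m) (A : 'M[R]_(m, k)) :
  closed K -> closed (Out H K A).
Proof.
move=> clK; apply: compact_closed; first exact: norm_hausdorff.
apply: continuous_compact; first by apply: continuous_subspaceT; exact: mulmx_continuous.
apply: (@cV_bounded_closed_compact _ _ _ 1).
  move=> p i [/O_outP[a_ge0 pa] p1 _].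
  have := coord_le_dot p i; rewrite -real_normK ?num_real// => h.
  apply: ler_of_sqr => //; rewrite (le_trans h)// (le_trans pa)//.
  by rewrite ler_pXn2r ?nnegrE.
have -> : [set z : 'cV[R]_k | [/\ O_out z, dot (ones R k) z <= 1 & K (A *m z)]] =
   @O_out R k `&` ((dot (ones R k) @^-1` [set r | r <= 1]) `&` (mulmx A @^-1` K)).
  by apply/seteqP; split=> z; [case|case=> ? []].
apply: closedI; first exact: O_out_closed.
apply: closedI; apply: preimage_closed => //.
- move=> z _; apply: (@dot_continuous _ _ _ (fun=> _) id); first exact: cst_continuous.
  by move=> ?.
- by move=> z _; exact: mulmx_continuous.
Qed.

Lemma closed_shrink n (C : set 'cV[R]_n) x : closed C ->
  (forall e : R, 0 < e -> C ((1 + e)^-1 *: x)) -> C x.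
Proof.
move=> clC Cx; apply: clC => B /nbhs_ballP[r /= r_gt0 rB].
pose M := `|x|.
(* The displacement has norm [e M / (1 + e)], less than [r] for this [e]; the added 1 allows
   [x = 0]. *)
pose e := r / (M + 1).
have M_ge0 : 0 <= M := normr_ge0 _.
have e_gt0 : 0 < e by rewrite divr_gt0//; lra.
exists ((1 + e)^-1 *: x); split; first exact: Cx.
apply: rB; rewrite -ball_normE/=.
rewrite -[X in X - _]scale1r -scalerBl normrZ.
have -> : 1 - (1 + e)^-1 = e / (1 + e) by field; lra.
have e1_gt0 : 0 < 1 + e by lra.
have M1_gt0 : 0 < M + 1 by lra.
rewrite ger0_norm ?divr_ge0 ?ltW// -/M mulrAC ltr_pdivrMr//.
have er : e * (M + 1) = r by rewrite divfK// gt_eqF.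
have : 0 < r * e by exact: mulr_gt0.
lra.
Qed.

End Duality.

Theorem theorem2p17 (R : realType) (n m f v : nat)
  (P : set 'cV[R]_n) (H : 'M[R]_(n, f)) (V : 'M[R]_(n, v))
  (K : set 'cV[R]_m) (A : 'M[R]_(m, f)) (B : 'M[R]_(m, v))
  (P_def : P = hpolyhedron H)
  (P_polytope : is_polytope P)
  (P_full : full_dimensional P)
  (P_int0 : interior P 0)
  (H_facets : facet_matrix P H)
  (V_vertices : vertex_matrix P V)
  (K_cone : closed_convex_cone K)
  (A_nonneg : nonneg_map (dual_cone K) A)
  (B_nonneg : nonneg_map K B)
  (InnP_closed : closed (Inn H K A))
  (InnPo_closed : closed (Inn V (dual_cone K) B)) :
  Out H (dual_cone K) A = polar (Inn H K A) /\
  Inn V (dual_cone K) B = polar (Out V K B).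
Proof.
have KD x y : K x -> K y -> K (x + y) by exact: closed_convex_coneD.
have [K_closed _ K_nonempty KZ] := K_cone.
have K0 : K 0 by have [x Kx] := K_nonempty; rewrite -(scale0r x); exact: KZ.
split; apply/seteqP; split=> [x xOut y yInn|z zpolar].
- by apply: dot_Out_Inn xOut yInn => a b; exact.
- apply: contrapT => zOut.
  have Out_conv x y t : Out H (dual_cone K) A x -> Out H (dual_cone K) A y ->
      0 <= t <= 1 -> Out H (dual_cone K) A (x + t *: (y - x)).
    move=> [p [pO p1 Ap] <-] [q [qO q1 Aq] <-] /andP[t0 t1].
    have t'0 : 0 <= 1 - t by lra.
    exists ((1 - t) *: p + t *: q).
      split; [by apply: O_outD; exact: O_outZ|by rewrite dotDr !dotZr; nra|].
      by rewrite mulmxDr -!scalemxAr; apply: dual_coneD; exact: dual_coneZ.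
    by rewrite mulmxDr -!scalemxAr; apply/colP => i; rewrite !mxE; ring.
  have Out0 : Out H (dual_cone K) A 0.
    exists 0; last by rewrite mulmx0.
    by split; [exact: O_out0|rewrite dot0r|rewrite mulmx0; exact: dual_cone0].
  have Out_cl : closed (Out H (dual_cone K) A) by apply: Out_closed; exact: dual_cone_closed.
  have [u [c [uc cz]]] := strict_separation Out_cl (ex_intro _ _ Out0) Out_conv zOut.
  have c_ge0 : 0 <= c by have := uc _ Out0; rewrite dot0r.
  (* A level strictly between [c] and [dot u z], positive even if [c = 0], so that [u] can be
     divided by it. *)
  pose b := (c + dot u z) / 2.
  have b_gt0 : 0 < b by rewrite /b; lra.
  have upolar : polar (Out H (dual_cone K) A) (b^-1 *: u).
    move=> x /uc ux; rewrite dotZl mulrC ler_pdivrMr// /b; lra.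
  (* Only the shrunken copies of [b^-1 *: u] are known to lie in [Inn]; each gives the bound
     [1 + e]. *)
  have : dot z (b^-1 *: u) <= 1.
    apply/ler_addgt0Pr => e e_gt0.
    have e1_gt0 : 0 < 1 + e by lra.
    have := zpolar _ (Inn_approx K0 KD KZ upolar e_gt0).
    by rewrite dotZr mulrC ler_pdivrMr// mul1r.
  by rewrite dotZr dotC mulrC ler_pdivrMr// /b; lra.
(* The roles are exchanged in this equality: [xOut] is membership in [Inn] and [yInn] membership in
   [Out]. *)
- by rewrite dotC; apply: dot_Out_Inn yInn xOut => a b Ka bK; rewrite dotC; exact: bK.
- apply: closed_shrink InnPo_closed _ => e e_gt0.
  apply: Inn_approx e_gt0; [exact: dual_cone0|exact: dual_coneD|exact: dual_coneZ|].
  move=> x [p [pO p1 Bp] <-]; apply: zpolar; exists p => //; split=> //.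
  (* Bipolarity: [B p] is in the dual of [dual_cone K], so no [w] in [dual_cone K] can separate it
     from the closed cone [K]. *)
  apply: contrapT => KBp.
  have [w wK] := cone_separation K_closed K_nonempty KD KZ KBp.
  by rewrite ltNge dotC Bp.
Qed.
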